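(* Let $(M,\sigma,\psi_{\pm})$ be a nearly Kähler six-manifold with a two-torus symmetry. Let $U,V$ be the infinitesimal generators of the action, let $\nu_M := \sigma(U,V)$ be the multi-moment map, and let $h^2 := g(U,U)\,g(V,V)-g(U,V)^2$. Let $p$ be a point of $M$. Then: 1. The vectors $U_p$ and $V_p$ are linearly dependent over $\mathbb{R}$ if and only if $p$ is a critical point of $\nu_M$ and $\nu_M(p)=0$. 2. The vectors $U_p$ and $V_p$ are linearly dependent over $\mathbb{C}$ (where $T_pM$ is a complex vector space via $J_p$) if and only if $p$ is a critical point of $\nu_M$. This is equivalent to $\nu_M^2 = h^2$ at $p$.
   Context: An $\mathrm{SU}(3)$-structure on a six-manifold $M$ consists of a Riemannian metric $g$, a $g$-orthogonal almost complex structure $J$, the two-form $\sigma = g(J\cdot,\cdot)$ and a complex $(3,0)$-form $\psi_{\mathbb{C}}=\psi_+ + i\psi_-$, such that at each point $p$ there is an orthonormal basis $\{E_i,JE_i\}_{i=1,2,3}$ of $T_pM$ with dual basis $\{e^i,Je^i\}_{i=1,2,3}$ satisfying $\sigma=\sum_{i} e^i\wedge Je^i$ and $\psi_{\mathbb{C}}=(e^1+iJe^1)\wedge(e^2+iJe^2)\wedge(e^3+iJe^3)$. A nearly Kähler six-manifold $(M,\sigma,\psi_\pm)$ is a six-manifold with an $\mathrm{SU}(3)$-structure satisfying $d\sigma = 3\psi_+$ and $d\psi_- = -2\sigma\wedge\sigma$. A two-torus symmetry is an effective smooth action of $T^2=\mathbb{S}^1\times\mathbb{S}^1$ on $M$ preserving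 $\sigma$ and $\psi_\pm$ (hence also $g$ and $J$). The infinitesimal generators $U,V$ are the (commuting) vector fields on $M$ induced by a basis of the Lie algebra of $T^2$. The function $\nu_M=\sigma(U,V)$ is $T^2$-invariant and satisfies $d\nu_M = 3\psi_+(U,V,\cdot)$; a point $p$ is critical if $d\nu_M$ vanishes at $p$. *)

(* Defs.v *)
From HB Require Import structures.
From mathcomp Require Import all_boot all_order all_algebra.
From mathcomp Require Import all_classical all_reals all_analysis.
From mathcomp Require Import perm complex.
Set Implicit Arguments.
Unset Strict Implicit.
Unset Printing Implicit Defensive.
Import Order.TTheory GRing.Theory Num.Theory numFieldNormedType.Exports.
Local Open Scope classical_set_scope.
Local Open Scope ring_scope.

(* C^k and C^oo on a set A, meant for A open; 'D_v f is the derivative of f in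
   the constant direction v. *)
Fixpoint Ck_on {R : realType} {V W : normedModType R} (k : nat) (A : set V)
    (f : V -> W) : Prop :=
  match k with
  | 0 => forall x, A x -> {for x, continuous f}
  | k'.+1 => (forall x, A x -> differentiable f x) /\
             (forall v : V, Ck_on k' A (fun x => 'D_v f x))
  end.

Definition smooth_on {R : realType} {V W : normedModType R} (A : set V)
  (f : V -> W) : Prop := forall k, Ck_on k A f.

(* chart_fun is only relevant on chart_dom, and chart_inv only on the image of
   chart_dom. *)
Record chart (R : realType) (n : nat) (M : topologicalType) := Chart {
  chart_dom : set M;
  chart_fun :> M -> 'rV[R]_n;
  chart_inv : 'rV[R]_n -> M;
  chart_dom_open : open chart_dom;
  chart_image_open : open (chart_fun @` chart_dom);
  chart_funK : forall q, chart_dom q -> chart_inv (chart_fun q) = q;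
  chart_fun_continuous : {within chart_dom, continuous chart_fun};
  chart_inv_continuous : {within chart_fun @` chart_dom, continuous chart_inv}
}.

Definition chart_image {R : realType} {n : nat} {M : topologicalType}
  (c : chart R n M) : set 'rV[R]_n := c @` chart_dom c.

(* The atlas need not be maximal. chart_at selects a preferred chart around each
   point, used below to model the tangent spaces. *)
Record manifold (R : realType) (n : nat) := Manifold {
  manifold_space :> topologicalType;
  atlas : set (chart R n manifold_space);
  chart_at : manifold_space -> chart R n manifold_space;
  chart_at_atlas : forall p, atlas (chart_at p);
  chart_at_dom : forall p, chart_dom (chart_at p) p;
  atlas_smooth : forall c d, atlas c -> atlas d ->
    smooth_on (c @` (chart_dom c `&` chart_dom d)) (d \o chart_inv c);
  manifold_hausdorff : hausdorff_space manifold_space;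
  manifold_second_countable : @second_countable manifold_space
}.

(* T_pM is modelled by R^n through the differential of the preferred chart at p;
   another chart around p enters through the derivative of the transition map
   (chart_tangent and chart_tangent_inv). *)
Definition tangent {R : realType} {n : nat} {M : manifold R n} (p : M) :
  vectType R := 'rV[R]_n.

Section Tangent.
Context {R : realType} {n : nat} {M : manifold R n}.

(* d(c)_q : T_qM -> R^n *)
Definition chart_tangent (c : chart R n M) (q : M) (v : tangent q) : 'rV[R]_n :=
  'd (c \o chart_inv (chart_at q)) (chart_at q q) v.

(* d(c^-1)_x : R^n -> T_(c^-1 x)M *)
Definition chart_tangent_inv (c : chart R n M) (x : 'rV[R]_n) (v : 'rV[R]_n) :
    tangent (chart_inv c x) :=
  'd (chart_at (chart_inv c x) \o chart_inv c) x v.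

Definition tangent_map (f : M -> M) (p : M) (v : tangent p) : tangent (f p) :=
  'd (chart_at (f p) \o (f \o chart_inv (chart_at p))) (chart_at p p) v.

Definition differential (f : M -> R) (p : M) (v : tangent p) : R :=
  'd (f \o chart_inv (chart_at p)) (chart_at p p) v.

Definition critical (f : M -> R) (p : M) : Prop :=
  forall v : tangent p, differential f v = 0.

End Tangent.

Definition ctensor {R : realType} {n : nat} (M : manifold R n) (k : nat) :=
  forall p : M, k.-tuple (tangent p) -> R.

Definition coord_expr {R : realType} {n : nat} {M : manifold R n} {k : nat}
    (w : ctensor M k) (c : chart R n M) (v : k.-tuple 'rV[R]_n)
    (x : 'rV[R]_n) : R :=
  w (chart_inv c x) [tuple chart_tangent_inv c x (tnth v i) | i < k].

Definition smooth_ctensor {R : realType} {n : nat} {M : manifold R n} {k : nat}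
    (w : ctensor M k) : Prop :=
  forall c, atlas c -> forall v, smooth_on (chart_image c) (coord_expr w c v).

Definition tuple_set {T : Type} {k : nat} (v : k.-tuple T) (i : 'I_k) (x : T) :
  k.-tuple T := [tuple if j == i then x else tnth v j | j < k].

Record form {R : realType} {n : nat} (M : manifold R n) (k : nat) := Form {
  form_val :> forall p : M, k.-tuple (tangent p) -> R;
  form_multilinear : forall p (v : k.-tuple (tangent p)) i (a : R)
      (x y : tangent p),
    form_val (tuple_set v i (a *: x + y)) =
    a * form_val (tuple_set v i x) + form_val (tuple_set v i y);
  form_alternating : forall p (v : k.-tuple (tangent p)) i j,
    i != j -> tnth v i = tnth v j -> form_val v = 0;
  form_smooth : smooth_ctensor form_val
}.

(* (dw)(v_0, ..., v_k) = \sum_i (-1)^i D_(v_i) (w(v_0, .., ^v_i, .., v_k)), the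
   v_j being extended as constant vector fields in the preferred chart at p. *)
Definition ext_d {R : realType} {n : nat} {M : manifold R n} {k : nat}
    (w : ctensor M k) : ctensor M k.+1 := fun p v =>
  \sum_(i < k.+1) (-1) ^+ i *
    'D_(tnth v i) (coord_expr w (chart_at p) [tuple tnth v (lift i j) | j < k])
      (chart_at p p).

(* Normalised so that (a /\ b)(u, v) = a(u) b(v) - a(v) b(u) on one-forms, in
   accordance with ext_d. *)
Definition wedge {F : fieldType} {V : Type} {k l : nat} (a : k.-tuple V -> F)
    (b : l.-tuple V -> F) : (k + l).-tuple V -> F := fun v =>
  (k`! * l`!)%:R^-1 * \sum_(s : 'S_(k + l)) (-1) ^+ s *
    (a [tuple tnth v (s (lshift l i)) | i < k] *
     b [tuple tnth v (s (rshift k i)) | i < l]).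

Definition oneform {F : fieldType} {V : Type} (a : V -> F) : 1.-tuple V -> F :=
  fun v => a (thead v).

Definition pullback {R : realType} {n : nat} {M : manifold R n} {k : nat}
    (f : M -> M) (w : ctensor M k) : ctensor M k := fun p v =>
  w (f p) [tuple tangent_map f (tnth v i) | i < k].

Definition preserves {R : realType} {n : nat} {M : manifold R n} {k : nat}
    (f : M -> M) (w : ctensor M k) : Prop :=
  forall p (v : k.-tuple (tangent p)), pullback f w v = w p v.

Record riemannian_metric {R : realType} {n : nat} (M : manifold R n) :=
    RiemannianMetric {
  metric_val :> forall p : M, tangent p -> tangent p -> R;
  metric_linear : forall p (a : R) (u v w : tangent p),
    metric_val (a *: u + v) w = a * metric_val u w + metric_val v w;
  metric_sym : forall p (u v : tangent p), metric_val u v = metric_val v u;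
  metric_pos : forall p (u : tangent p), u != 0 -> 0 < metric_val u u;
  metric_smooth : smooth_ctensor (fun p (v : 2.-tuple (tangent p)) =>
    metric_val (tnth v ord0) (tnth v ord_max))
}.

Record almost_complex {R : realType} {n : nat} (M : manifold R n) :=
    AlmostComplex {
  acs_val :> forall p : M, 'End(tangent p);
  acs_sqr : forall p (v : tangent p), acs_val p (acs_val p v) = - v;
  acs_smooth : forall c, atlas c -> forall v : 'rV[R]_n,
    smooth_on (chart_image c) (fun x =>
      chart_tangent c (acs_val (chart_inv c x) (chart_tangent_inv c x v)))
}.

(* The basis X = (E_1, E_2, E_3, J E_1, J E_2, J E_3) of T_pM has dual basis
   (e^1, e^2, e^3, Je^1, Je^2, Je^3), given by coord X. *)
Definition su3_adapted {R : realType} {M : manifold R 6}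
    (g : riemannian_metric M) (J : almost_complex M)
    (sigma : form M 2) (psip psim : form M 3) (p : M) : Prop :=
  exists E : 3.-tuple (tangent p),
    let X : (3 + 3).-tuple (tangent p) := [tuple of E ++ map (J p) E] in
    let e (i : 'I_3) (v : tangent p) : R := coord X (lshift 3 i) v in
    let Je (i : 'I_3) (v : tangent p) : R := coord X (rshift 3 i) v in
    let theta (i : 'I_3) (v : tangent p) : R[i] := (e i v +i* Je i v)%C in
    [/\ basis_of fullv X,
        forall i j, g p (tnth X i) (tnth X j) = (i == j)%:R,
        forall v : 2.-tuple (tangent p),
          sigma p v = \sum_(i < 3) wedge (oneform (e i)) (oneform (Je i)) v
      & forall v : 3.-tuple (tangent p),
          (psip p v +i* psim p v)%C =
          wedge (wedge (oneform (theta (inord 0))) (oneform (theta (inord 1))))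
                (oneform (theta (inord 2))) v].

Record su3_structure {R : realType} (M : manifold R 6) := SU3Structure {
  su3_g : riemannian_metric M;
  su3_J : almost_complex M;
  su3_sigma : form M 2;
  su3_psip : form M 3;
  su3_psim : form M 3;
  su3_J_orthogonal : forall p (u v : tangent p),
    su3_g p (su3_J p u) (su3_J p v) = su3_g p u v;
  su3_sigmaE : forall p (u v : tangent p),
    su3_sigma p [tuple u; v] = su3_g p (su3_J p u) v;
  su3_frame : forall p, su3_adapted su3_g su3_J su3_sigma su3_psip su3_psim p
}.

Definition nearly_kahler {R : realType} {M : manifold R 6}
    (S : su3_structure M) : Prop :=
  (forall p (v : 3.-tuple (tangent p)),
     ext_d (su3_sigma S) v = 3 * su3_psip S p v) /\
  (forall p (v : 4.-tuple (tangent p)),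
     ext_d (su3_psim S) v = - 2 * wedge (su3_sigma S p) (su3_sigma S p) v).

(* T^2 = S^1 x S^1, inside the ring C x C with componentwise product *)
Definition torus2 {R : realType} (z : R[i] * R[i]) : Prop :=
  `|z.1| = 1 /\ `|z.2| = 1.

(* The exponential map R^2 = Lie(T^2) -> T^2 *)
Definition torus2_exp {R : realType} (t : 'rV[R]_2) : R[i] * R[i] :=
  ((cos (t ord0 ord0) +i* sin (t ord0 ord0))%C,
   (cos (t ord0 ord_max) +i* sin (t ord0 ord_max))%C).

(* Smoothness of the action map T^2 x M -> M. The local inverses of torus2_exp
   are the charts of T^2, so this is smoothness of the composite with
   torus2_exp x id, read in the charts of M. *)
Definition smooth_torus_action {R : realType} {n : nat} {M : manifold R n}
    (act : R[i] * R[i] -> M -> M) : Prop :=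
  continuous (fun z : 'rV[R]_2 * M => act (torus2_exp z.1) z.2) /\
  forall c d, atlas c -> atlas d ->
    smooth_on
      [set z : 'rV[R]_2 * 'rV[R]_n | chart_image c z.2 /\
         chart_dom d (act (torus2_exp z.1) (chart_inv c z.2))]
      (fun z => d (act (torus2_exp z.1) (chart_inv c z.2))).

(* The values of act outside torus2 are irrelevant. *)
Record two_torus_symmetry {R : realType} {M : manifold R 6}
    (S : su3_structure M) (act : R[i] * R[i] -> M -> M) : Prop :=
    TwoTorusSymmetry {
  tts_one : forall q, act 1 q = q;
  tts_mul : forall z w q, torus2 z -> torus2 w ->
    act (z * w) q = act z (act w q);
  tts_smooth : smooth_torus_action act;
  tts_effective : forall z, torus2 z -> (forall q, act z q = q) -> z = 1;
  tts_sigma : forall z, torus2 z -> preserves (act z) (su3_sigma S);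
  tts_psip : forall z, torus2 z -> preserves (act z) (su3_psip S);
  tts_psim : forall z, torus2 z -> preserves (act z) (su3_psim S)
}.

(* p |-> d/dt exp(t xi) . p at t = 0 *)
Definition generator {R : realType} {n : nat} {M : manifold R n}
    (act : R[i] * R[i] -> M -> M) (xi : 'rV[R]_2) (p : M) : tangent p :=
  derive1 (fun t : R => chart_at p (act (torus2_exp (t *: xi)) p)) 0.

(* Scalar multiplication (a + b i) . v = a v + b J v on T_pM *)
Definition cscale {R : realType} {n : nat} {M : manifold R n}
    (J : almost_complex M) (p : M) (z : R[i]) (v : tangent p) : tangent p :=
  complex.Re z *: v + complex.Im z *: J p v.

Definition complex_dependent {R : realType} {n : nat} {M : manifold R n}
    (J : almost_complex M) (p : M) (u v : tangent p) : Prop :=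
  exists z w : R[i], (z, w) != (0, 0) /\ cscale J z u + cscale J w v = 0.

(* Main.v *)
Require Import Defs.
From HB Require Import structures.
From mathcomp Require Import all_boot all_order all_algebra.
From mathcomp Require Import all_classical all_reals all_analysis.
From mathcomp Require Import perm complex.
From mathcomp Require Import ring.
Set Implicit Arguments.
Unset Strict Implicit.
Unset Printing Implicit Defensive.
Import Order.TTheory GRing.Theory Num.Theory numFieldNormedType.Exports.
Local Open Scope ring_scope.

(* Write U, V for the generators and sigma for the two-form. Near p, in the
   preferred chart, the action is a smooth local map F(z, x) with z in the Lie
   algebra of the torus. Differentiating the invariance of sigma along the flow
   gives L_U sigma = L_V sigma = 0 and differentiating the commutation of the flows
   gives [U, V] = 0 (both use the symmetry of second derivatives), whence Cartan's
   formula d(sigma(U, V)) = d sigma(U, V, .) = 3 psi_+(U, V, .).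
   In an adapted frame, psi_+(U, V, .) is given by the complex cross product of
   U and V, so p is critical exactly when this cross product vanishes. By
   Lagrange's identity its squared norm is h^2 - nu^2, the Gram determinant of U, V
   for the Hermitian form g + i sigma, which vanishes exactly when U and V are
   linearly dependent over C. *)

Local Open Scope classical_set_scope.
Local Open Scope ring_scope.

(** * Differentials as germs, mean values along lines, symmetry of second derivatives *)

Section Calculus.
Context {R : realType} {V : normedModType R}.

(** The remainder of the first-order expansion at [x] only sees the germ of the function. This
    allows identities that hold only inside a chart domain to be differentiated. *)
Lemma near_eq_is_diff (W : normedModType R) (f g : V -> W) x :
  (\near x, f x = g x) -> differentiable f x -> is_diff x g ('d f x).
Proof.
move=> fg df.
have gE : g \o shift x = cst (g x) + 'd f x +o_ 0 id.
  apply/eqaddoP => e e0.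
  have /eqaddoP/(_ e e0) fo := diff_locally df.
  have fg0 : \forall h \near (0 : V), f (h + x) = g (h + x).
    by move: fg; rewrite (near_shift 0 x); apply: filterS => h; rewrite /= subr0.
  rewrite -(nbhs_singleton fg).
  by near=> h; rewrite !fctE /= -(near fg0 h) //; near: h; exact: fo.
have dgE : 'd g x = 'd f x :> (V -> W).
  by apply: diff_unique gE; exact: diff_continuous.
apply: DiffDef => //; apply/diff_locallyP; rewrite dgE; split=> //.
exact: diff_continuous.
Unshelve. all: by end_near. Qed.

Lemma is_derive_line (W : normedModType R) (f : V -> W) a u (s : R) df :
  is_derive (a + s *: u) u f df -> is_derive s 1 (fun r => f (a + r *: u)) df.
Proof.
have E : (fun h : R => h^-1 *: (((fun r => f (a + r *: u)) \o shift s) (h *: 1)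
          - f (a + s *: u))) =
         (fun h => h^-1 *: ((f \o shift (a + s *: u)) (h *: u) - f (a + s *: u))).
  apply/funext => h /=; congr (_ *: (f _ - _)).
  by rewrite [h *: 1]mulr1 scalerDl addrCA.
move=> [fd <-]; apply: DeriveDef.
  by move: fd; rewrite /derivable -E.
by rewrite /derive -E.
Qed.

Lemma mean_value_line (f df : V -> R) a u (h : R) : 0 < h ->
  (forall s, 0 <= s <= h -> is_derive (a + s *: u) u f (df (a + s *: u))) ->
  exists2 s, 0 <= s <= h & f (a + h *: u) - f a = h * df (a + s *: u).
Proof.
move=> h0 fd.
have fd' s : 0 <= s <= h ->
    is_derive s 1 (fun r => f (a + r *: u)) (df (a + s *: u)).
  by move=> sh; apply: is_derive_line; exact: fd.
have [s||s] := @MVT_segment _ (fun r => f (a + r *: u))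
                 (fun r => df (a + r *: u)) 0 h (ltW h0).
- by rewrite in_itv /= => /andP[s0 sh]; apply: fd'; rewrite !ltW.
- apply: derivable_within_continuous => s; rewrite in_itv /= => sh.
  by have [] := fd' s sh.
- rewrite in_itv /= => sh; rewrite scale0r addr0 subr0 => ->.
  by exists s => //; rewrite mulrC.
Qed.

(** Two applications of the mean value theorem: along [u] to the increment [f (x + h *: v) - f x],
    then along [v] to [fu]. *)
Lemma second_difference (f fu fuv : V -> R) a u v (h : R) : 0 < h ->
  (forall s t, 0 <= s <= h -> 0 <= t <= h ->
    is_derive (a + s *: u + t *: v) u f (fu (a + s *: u + t *: v)) /\
    is_derive (a + s *: u + t *: v) v fu (fuv (a + s *: u + t *: v))) ->
  exists s t, [/\ 0 <= s <= h, 0 <= t <= h &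
    f (a + h *: u + h *: v) - f (a + h *: v) - (f (a + h *: u) - f a) =
    h ^+ 2 * fuv (a + s *: u + t *: v)].
Proof.
move=> h0 H; have hh : 0 <= h <= h by rewrite lexx ltW.
have h00 : 0 <= (0 : R) <= h by rewrite lexx ltW.
have [s|s sh E] := @mean_value_line
    (fun x => f (x + h *: v) - f x) (fun x => fu (x + h *: v) - fu x) a u h h0.
  move=> sh; apply: is_deriveB.
    have [[fd fE] _] := H s h sh hh.
    have C : (fun h0 : R => h0^-1 *:
       (((fun x => f (x + h *: v)) \o shift (a + s *: u)) (h0 *: u) -
         f (a + s *: u + h *: v))) = (fun h0 : R => h0^-1 *:
       ((f \o shift (a + s *: u + h *: v)) (h0 *: u) - f (a + s *: u + h *: v))).
      by apply/funext => k /=; rewrite -!addrA.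
    apply: DeriveDef.
      by rewrite /derivable C.
    by rewrite /derive C.
  by have [] := H s 0 sh h00; rewrite scale0r addr0.
have [t|t th E'] := @mean_value_line fu fuv (a + s *: u) v h h0.
  by move=> th; have [] := H s t sh th.
exists s, t; split=> //.
have -> : f (a + h *: u + h *: v) - f (a + h *: v) - (f (a + h *: u) - f a) =
   f (a + h *: u + h *: v) - f (a + h *: u) - (f (a + h *: v) - f a) by ring.
by rewrite E E' mulrA expr2.
Qed.

(** Schwarz's theorem. The second difference is symmetric in [u] and [v], so [fuv] and [fvu] take a
    common value at two possibly different points of a small parallelogram; continuity at [a] puts
    both values at [a] within [e / 2] of it. *)
Lemma mixed_derivatives_eq (f fu fv fuv fvu : V -> R) a u v :
  (\forall x \near a, [/\ is_derive x u f (fu x), is_derive x v f (fv x),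
     is_derive x v fu (fuv x) & is_derive x u fv (fvu x)]) ->
  {for a, continuous fuv} -> {for a, continuous fvu} -> fuv a = fvu a.
Proof.
move=> H cuv cvu; apply/eqP; rewrite -subr_eq0 -normr_le0.
apply/ler_addgt0Pl => e e0; rewrite addr0.
have e2 : 0 < e / 2 by rewrite divr_gt0.
have : \forall x \near a, [/\ [/\ is_derive x u f (fu x), is_derive x v f (fv x),
     is_derive x v fu (fuv x) & is_derive x u fv (fvu x)],
     `|fuv a - fuv x| < e / 2 & `|fvu a - fvu x| < e / 2].
  near=> x; split; first by near: x.
    by near: x; move/cvgrPdist_lt: cuv; exact.
  by near: x; move/cvgrPdist_lt: cvu; exact.
move=> /nbhs_ballP[d /= d0 dP].
(* With this size [h] times the denominator is [d / 2], so the whole parallelogram lies in the ball;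
   the summand 1 keeps the denominator positive when [u] and [v] vanish. *)
pose h := d / 2 / (`|u| + `|v| + 1).
have uv0 : 0 < `|u| + `|v| + 1 by rewrite ltr_wpDl ?addr_ge0.
have h0 : 0 < h by rewrite !divr_gt0.
have inball s t : 0 <= s <= h -> 0 <= t <= h -> ball a d (a + s *: u + t *: v).
  move=> /andP[s0 sh] /andP[t0 th]; rewrite -ball_normE /=.
  rewrite -addrA opprD addNKr normrN.
  apply: le_lt_trans (ler_normD _ _) _; rewrite !normrZ !ger0_norm //.
  apply: (@le_lt_trans _ _ (h * (`|u| + `|v| + 1))).
    rewrite !mulrDr mulr1; apply: ler_wpDr; first exact: ltW.
    by apply: lerD; apply: ler_wpM2r.
  by rewrite /h divfK ?gt_eqF // ltr_pdivrMr // ltr_pMr // ltr1n.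
have [s t|s [t [sh th E]]] := @second_difference f fu fuv a u v h h0.
  by move=> sh th; have [[]] := dP _ (inball s t sh th).
have [t' s'|t' [s' [th' sh' E']]] := @second_difference f fv fvu a v u h h0.
  move=> th' sh'; have [[]] := dP _ (inball s' t' sh' th').
  by rewrite addrAC.
have {E E'} E : fuv (a + s *: u + t *: v) = fvu (a + s' *: u + t' *: v).
  have h2 : h ^+ 2 != 0 by rewrite expf_neq0 // gt_eqF.
  apply: (mulfI h2); rewrite -E [a + s' *: u + _]addrAC -E'.
  by rewrite [a + h *: u + _]addrAC; ring.
have [_ A1 _] := dP _ (inball s t sh th).
have [_ _ A2] := dP _ (inball s' t' sh' th').
rewrite -(subrKA (fuv (a + s *: u + t *: v))) {2}E.
rewrite (le_trans (ler_normD _ _)) // [leRHS]splitr.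
by rewrite lerD // ltW // distrC.
Unshelve. all: by end_near. Qed.

Lemma is_derive_coord m n (f : V -> 'M[R]_(m, n)) a u df i j :
  is_derive a u f df -> is_derive a u (fun x => f x i j) (df i j).
Proof.
move=> [fd <-]; apply: DeriveDef; first by move/derivable_mxP: fd; exact.
by rewrite derive_mx // mxE.
Qed.

Lemma mixed_derivatives_mx_eq m n (A : set V) (f : V -> 'M[R]_(m, n)) a u v :
  nbhs a A -> Ck_on 2 A f -> 'D_v ('D_u f) a = 'D_u ('D_v f) a.
Proof.
move=> aA [df C1]; have Aa := nbhs_singleton aA.
have cc g (x : V) i j : {for x, continuous g} ->
    {for x, continuous (fun y => (g y : 'M[R]_(m, n)) i j)}.
  by move=> cg; apply: (@continuous_comp _ _ _ g (fun B : 'M[R]_(m, n) => B i j));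
    [|exact: coord_continuous].
apply/matrixP => i j.
apply: (@mixed_derivatives_eq (fun x => f x i j) (fun x => 'D_u f x i j)
  (fun x => 'D_v f x i j) (fun x => 'D_v ('D_u f) x i j)
  (fun x => 'D_u ('D_v f) x i j) a u v).
- near=> x; have Ax : A x by near: x.
  have dfx := df x Ax; have [Cu _] := C1 u; have [Cv _] := C1 v.
  by split; apply: is_derive_coord; apply: derivableP; apply: diff_derivable => //;
    [exact: Cu | exact: Cv].
- by apply: cc; have [_ /(_ v)] := C1 u; apply.
- by apply: cc; have [_ /(_ u)] := C1 v; apply.
Unshelve. all: by end_near. Qed.

End Calculus.

(** * Conversions between differentials, derivatives and coordinates *)

Lemma is_diff_apply (R : numFieldType) (V W : normedModType R) (f df : V -> W) x v :
  is_diff x f df -> 'd f x v = df v.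
Proof. by move=> [_ ->]. Qed.

Lemma is_diff_deriveE (R : numFieldType) (V W : normedModType R) (f df : V -> W) x v :
  is_diff x f df -> 'D_v f x = df v.
Proof. by move=> [fd <-]; rewrite deriveE. Qed.

Lemma is_derive_is_diff {R : realType} {W : normedModType R} (f : R -> W) (s : R) df :
  is_derive s 1 f df -> is_diff s f (fun h => h *: df).
Proof.
move=> [/derivable1_diffP fd fE]; apply: DiffDef => //.
by apply/funext => h; rewrite diff1E // derive1E fE.
Qed.

Lemma linear_functional_sum (R : pzRingType) n (f : 'rV[R]_n -> R) :
  (forall k a b, f (k *: a + b) = k * f a + f b) ->
  forall a, f a = \sum_i a ord0 i * f (delta_mx ord0 i).
Proof.
move=> fl a; have f0 : f 0 = 0.
  by apply: (addIr (f 0)); rewrite add0r -{1}[f 0]mul1r -fl scaler0 addr0.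
rewrite {1}(row_sum_delta a).
elim/big_rec2: _ => [//|i y z _ <-]; exact: fl.
Qed.

Lemma is_diff_coord {R : realType} {V : normedModType R} n
    (C dC : V -> 'rV[R]_n) z k :
  is_diff z C dC -> is_diff z (fun t => C t ord0 k) (fun v => dC v ord0 k).
Proof.
move=> [Cd <-]; have dc : differentiable (fun t => C t ord0 k) z.
  by apply: (differentiable_comp (g := fun M : 'rV[R]_n => M ord0 k)) => //;
     exact: differentiable_coord.
apply: DiffDef => //; apply/funext => v; rewrite -deriveE // -deriveE //.
by have [_ ->] := is_derive_coord ord0 k (derivableP (diff_derivable (v := v) Cd)).
Qed.

(** * Leibniz rule for a bilinear form depending on the point *)

Section VariableBilinearForm.
Context {R : realType} {n : nat}.
Implicit Types (a b : 'rV[R]_n).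

Variable w : 'rV[R]_n -> 'rV[R]_n -> 'rV[R]_n -> R.
Hypothesis wl : forall x k a a' b, w x (k *: a + a') b = k * w x a b + w x a' b.
Hypothesis wr : forall x k a b b', w x a (k *: b + b') = k * w x a b + w x a b'.

Let e i : 'rV[R]_n := delta_mx ord0 i.

Let wE x a b : w x a b = \sum_i \sum_j a ord0 i * b ord0 j * w x (e i) (e j).
Proof.
rewrite (linear_functional_sum (f := w x ^~ b)) => [|k c d]; last exact: wl.
apply: eq_bigr => i _; rewrite (linear_functional_sum (f := w x (e i))) => [|k c d];
  last exact: wr.
by rewrite big_distrr /=; apply: eq_bigr => j _; rewrite mulrA.
Qed.

(** Expanding both vectors in the standard basis turns the value into a finite sum of products of
    three real functions, each handled by the product rule. *)
Let is_diff_sum (V : normedModType R) (Y A B dY dA dB : V -> 'rV[R]_n) z :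
  is_diff z Y dY -> is_diff z A dA -> is_diff z B dB ->
  (forall a b, differentiable (fun x => w x a b) (Y z)) ->
  is_diff z (fun t => w (Y t) (A t) (B t)) (fun v => \sum_i \sum_j
    (A z ord0 i * B z ord0 j * 'd (fun x => w x (e i) (e j)) (Y z) (dY v)
     + dA v ord0 i * B z ord0 j * w (Y z) (e i) (e j)
     + A z ord0 i * dB v ord0 j * w (Y z) (e i) (e j))).
Proof.
move=> YD AD BD dw.
pose T i j := ((fun t => A t ord0 i) * (fun t => B t ord0 j)) *
              ((fun x => w x (e i) (e j)) \o Y).
have Td i j : is_diff z (T i j) (fun v =>
    A z ord0 i * B z ord0 j * 'd (fun x => w x (e i) (e j)) (Y z) (dY v)
     + dA v ord0 i * B z ord0 j * w (Y z) (e i) (e j)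
     + A z ord0 i * dB v ord0 j * w (Y z) (e i) (e j)).
  have dAi := is_diff_coord i AD; have dBj := is_diff_coord j BD.
  have dwY := is_diff_comp YD (differentiableP (dw (e i) (e j))).
  have D := @is_diffM _ _ _ _ _ _ z (@is_diffM _ _ _ _ _ _ z dAi dBj) dwY.
  apply: (@is_diff_eq _ _ _ _ _ _ _ D); apply/funext => v.
  rewrite -[LHS]/(A z ord0 i * B z ord0 j *
      'd (fun x => w x (e i) (e j)) (Y z) (dY v) + w (Y z) (e i) (e j) *
      (A z ord0 i * dB v ord0 j + B z ord0 j * dA v ord0 i)).
  by ring.
have Fd : (fun t => w (Y t) (A t) (B t)) = \sum_i \sum_j T i j.
  apply/funext => t; rewrite wE fct_sumE; apply: eq_bigr => i _.
  by rewrite fct_sumE.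
have dd : differentiable (\sum_i \sum_j T i j) z.
  by apply: differentiable_sum => i; apply: differentiable_sum => j.
rewrite Fd; apply: DiffDef => //; apply/funext => v; rewrite -deriveE //.
rewrite derive_sum; last first.
  by move=> i; apply: diff_derivable; apply: differentiable_sum => j.
apply: eq_bigr => i _; rewrite derive_sum; last first.
  by move=> j; apply: diff_derivable.
by apply: eq_bigr => j _; rewrite deriveE // diff_val.
Qed.

(** The values at [z] get names of their own so that the rule applies when they are known only
    through equations, as for a flow at time [0 *: zeta]. *)
Lemma is_diff_variable_bilinear (V : normedModType R)
    (Y A B dY dA dB : V -> 'rV[R]_n) z y a b :
  is_diff z Y dY -> is_diff z A dA -> is_diff z B dB ->
  Y z = y -> A z = a -> B z = b ->
  (forall c d, differentiable (fun x => w x c d) y) ->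
  is_diff z (fun t => w (Y t) (A t) (B t)) (fun v =>
    'd (fun x => w x a b) y (dY v) + w y (dA v) b + w y a (dB v)).
Proof.
move=> YD AD BD <- <- <- dw; have H := is_diff_sum YD AD BD dw.
apply: (@is_diff_eq _ _ _ _ _ _ _ H); apply/funext => v.
(* The same formula with constant vectors computes the differential of the coefficients alone, which
   identifies the first group of terms. *)
have Hc := is_diff_sum (is_diff_id (Y z)) (is_diff_cst (A z) (Y z))
  (is_diff_cst (B z) (Y z)) dw.
rewrite (is_diff_apply (dY v) Hc) [w _ (dA v) _]wE [w _ _ (dB v)]wE.
rewrite -!big_split /=; apply: eq_bigr => i _.
rewrite -!big_split /=; apply: eq_bigr => j _.
rewrite -[(0 : _ -> 'rV_n) _]/(0 : 'rV_n) !mxE.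
by rewrite !(mul0r, mulr0, addr0).
Qed.

Lemma is_derive_variable_bilinear (Y A B : R -> 'rV[R]_n) dY dA dB (z : R) y a b :
  is_derive z 1 Y dY -> is_derive z 1 A dA -> is_derive z 1 B dB ->
  Y z = y -> A z = a -> B z = b ->
  (forall c d, differentiable (fun x => w x c d) y) ->
  is_derive z 1 (fun t => w (Y t) (A t) (B t))
    ('d (fun x => w x a b) y dY + w y dA b + w y a dB).
Proof.
move=> YD AD BD Yz Az Bz dw.
have D := is_diff_variable_bilinear (is_derive_is_diff YD) (is_derive_is_diff AD)
  (is_derive_is_diff BD) Yz Az Bz dw.
apply: DeriveDef; first by apply: diff_derivable; exact: (@ex_diff _ _ _ _ _ _ _ D).
by rewrite (is_diff_deriveE _ D) !scale1r.
Qed.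

End VariableBilinearForm.

(** * Local flows: generators, their bracket, invariant two-forms *)

Lemma near_line_dom {R : realType} {E V : normedModType R} (A : set (E * V)) zeta x0 :
  nbhs ((0, x0) : E * V) A -> \forall s \near (0 : R), A (s *: zeta, x0).
Proof.
move=> A0.
have c : (fun s : R => (s *: zeta, x0) : E * V) s @[s --> 0] --> ((0, x0) : E * V).
  apply: (@cvg_pair _ _ _ _ (nbhs (0 : E)) (nbhs x0)); last exact: cvg_cst.
  by have := @scalel_continuous R E zeta 0; rewrite /continuous_at scale0r.
exact: c A0.
Qed.

Section LocalFlow.
Context {R : realType} {E : normedModType R} {n : nat}.
Variables (F : E * 'rV[R]_n -> 'rV[R]_n) (A : set (E * 'rV[R]_n)) (x0 : 'rV[R]_n).
Hypotheses (A0 : nbhs ((0, x0) : E * 'rV[R]_n) A) (C2 : Ck_on 2 A F).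
Hypothesis F0_near : \forall x \near x0, F (0, x) = x.

Let F0 : F (0, x0) = x0. Proof. exact: nbhs_singleton F0_near. Qed.

Definition flow_generator (zeta : E) (x : 'rV[R]_n) : 'rV[R]_n :=
  'D_(zeta, 0) F (0, x).

(* The differential of flow_generator zeta at x0. *)
Let lin (zeta : E) (a : 'rV[R]_n) : 'rV[R]_n := 'D_(0, a) ('D_(zeta, 0) F) (0, x0).

Let A00 : A (0, x0). Proof. exact: nbhs_singleton. Qed.

Let F_diff z : A z -> differentiable F z. Proof. by have [+ _] := C2; apply. Qed.

Let DF_diff u z : A z -> differentiable ('D_u F) z.
Proof. by have [_ /(_ u)[+ _]] := C2; apply. Qed.

Let pair_lineE (s : R) (zeta : E) (x : 'rV[R]_n) :
  (0, x) + s *: (zeta, 0) = (s *: zeta, x) :> E * 'rV[R]_n.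
Proof. by rewrite -[LHS]/(0 + s *: zeta, x + s *: 0) scaler0 addr0 add0r. Qed.

Let is_derive_flow (W : normedModType R) (G : E * 'rV[R]_n -> W) zeta x :
  differentiable G (0, x) ->
  is_derive (0 : R) 1 (fun r => G (r *: zeta, x)) ('D_(zeta, 0) G (0, x)).
Proof.
move=> dG; under eq_fun do rewrite -pair_lineE.
apply: is_derive_line; rewrite pair_lineE scale0r; apply: derivableP.
exact: diff_derivable.
Qed.

Lemma is_diff_flow_generator zeta :
  is_diff x0 (flow_generator zeta) (lin zeta).
Proof.
have D1 : is_diff x0 (fun x => (cst (0 : E) x, id x)) (fun a => (0 a, id a)).
  exact: is_diff_pair.
have D := is_diff_comp D1 (differentiableP (DF_diff (zeta, 0) A00)).
apply: (@is_diff_eq _ _ _ _ _ _ _ D); apply/funext => a.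
by rewrite /lin deriveE; [|exact: DF_diff].
Qed.

Lemma is_derive_flow_curve zeta :
  is_derive (0 : R) 1 (fun s => F (s *: zeta, x0)) (flow_generator zeta x0).
Proof. by apply: is_derive_flow; exact: F_diff. Qed.

(** By symmetry of second derivatives, the time derivative of the spatial differential of [F] is the
    spatial derivative of its time derivative, the generator. *)
Let is_derive_tangent_flow zeta a :
  is_derive (0 : R) 1 (fun s => 'd (fun x => F (s *: zeta, x)) x0 a) (lin zeta a).
Proof.
have : is_derive (0 : R) 1 (fun s => 'D_(0, a) F (s *: zeta, x0)) (lin zeta a).
  rewrite /lin -(mixed_derivatives_mx_eq (0, a) (zeta, 0) A0 C2).
  by apply: is_derive_flow; exact: DF_diff.
apply: near_eq_is_derive; near=> s.
have As : A (s *: zeta, x0) by near: s; exact: (near_line_dom zeta A0).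
have D1 : is_diff x0 (fun x => (cst (s *: zeta) x, id x)) (fun a => (0 a, id a)).
  exact: is_diff_pair.
have D := is_diff_comp D1 (differentiableP (F_diff As)).
by rewrite (deriveE _ (F_diff As)) (is_diff_apply a D).
Unshelve. all: by end_near. Qed.

(* The right-hand side is symmetric in zeta and chi, so the Lie bracket of the
   two generators vanishes at x0. *)
Lemma flow_generators_commute zeta chi :
  (\forall s \near (0 : R), \forall r \near (0 : R),
    F (r *: zeta, F (s *: chi, x0)) = F (r *: zeta + s *: chi, x0)) ->
  lin zeta (flow_generator chi x0) = 'D_(chi, 0) ('D_(zeta, 0) F) (0, x0).
Proof.
move=> H.
have D1 : is_derive (0 : R) 1 (fun s => 'D_(zeta, 0) F (s *: chi, x0))
    ('D_(chi, 0) ('D_(zeta, 0) F) (0, x0)).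
  by apply: is_derive_flow; exact: DF_diff.
have D3 := is_derive_is_diff (is_derive_flow_curve chi).
have D2 : is_diff (F (0 *: chi, x0)) (flow_generator zeta) (lin zeta).
  by rewrite scale0r F0; exact: is_diff_flow_generator.
have D4 := is_diff_comp D3 D2.
have E4 : 'D_1 (flow_generator zeta \o (fun s : R => F (s *: chi, x0))) 0 =
    lin zeta (flow_generator chi x0).
  by rewrite (is_diff_deriveE _ D4) /= scale1r.
(* For small [s], the group law makes the generator at the moved point [F (s *: chi, x0)] equal to
   the derivative of [F] itself at [(s *: chi, x0)]; the two functions of [s] then have the same
   derivative at 0. *)
rewrite -E4; have [_ <-] := D1; apply: near_eq_derive.
near=> s.
have As : A (s *: chi, x0) by near: s; exact: (near_line_dom chi A0).
have As' : A (0, F (s *: chi, x0)).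
  near: s.
  have c1 := differentiable_continuous (@ex_diff _ _ _ _ _ _ _ D3).
  have z0 : F (0 *: chi, x0) = x0 by rewrite scale0r F0.
  have c2 : (fun s : R => F (s *: chi, x0)) @ (0 : R) --> x0 by rewrite -[X in _ --> X]z0.
  have c : (fun s : R => (0 : E, F (s *: chi, x0))) @ (0 : R) --> ((0, x0) : E * 'rV[R]_n).
    exact: (cvg_pair (cvg_cst (0 : E)) c2).
  exact: c A0.
have [_ E1] : is_derive (0 : R) 1 (fun r => F (r *: zeta, F (s *: chi, x0)))
    (flow_generator zeta (F (s *: chi, x0))).
  by apply: is_derive_flow; exact: F_diff.
have [_ E2] : is_derive (0 : R) 1 (fun r => F (r *: zeta + s *: chi, x0))
    ('D_(zeta, 0) F (s *: chi, x0)).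
  have Er r : (r *: zeta + s *: chi, x0) = (s *: chi, x0) + r *: (zeta, 0) :> E * 'rV[R]_n.
    by rewrite -[RHS]/(s *: chi + r *: zeta, x0 + r *: 0) scaler0 addr0 (addrC (s *: _)).
  under eq_fun do rewrite Er.
  apply: is_derive_line; rewrite scale0r addr0; apply: derivableP.
  by apply: diff_derivable; exact: F_diff.
rewrite /= -E1 -E2; apply: near_eq_derive.
by near: s; exact: H.
Unshelve. all: by end_near. Qed.

Section InvariantTwoForm.
Variable w : 'rV[R]_n -> 'rV[R]_n -> 'rV[R]_n -> R.
Hypothesis wl : forall x k a a' b, w x (k *: a + a') b = k * w x a b + w x a' b.
Hypothesis wr : forall x k a b b', w x a (k *: b + b') = k * w x a b + w x a b'.
Hypothesis w_skew : forall x a b, w x a b = - w x b a.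
Hypothesis w_diff : forall a b, differentiable (fun x => w x a b) x0.

(* The Lie derivative of w along the flow vanishes. *)
Let lie_derivative_eq0 zeta a b :
  (\forall s \near (0 : R), w (F (s *: zeta, x0)) ('d (fun x => F (s *: zeta, x)) x0 a)
     ('d (fun x => F (s *: zeta, x)) x0 b) = w x0 a b) ->
  'D_(flow_generator zeta x0) (fun x => w x a b) x0 =
  - (w x0 (lin zeta a) b + w x0 a (lin zeta b)).
Proof.
move=> H.
have z0 : F (0 *: zeta, x0) = x0 by rewrite scale0r.
(* The time-zero map is known to be the identity only near [x0], which suffices for its
   differential. *)
have t0 c : 'd (fun x => F (0 *: zeta, x)) x0 c = c.
  have D : is_diff x0 (fun x => F (0 *: zeta, x)) ('d id x0).
    apply: near_eq_is_diff; last exact: (@ex_diff _ _ _ _ _ _ _ (is_diff_id x0)).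
    by apply: filterS F0_near => x; rewrite scale0r.
  rewrite (is_diff_apply c D).
  by rewrite (is_diff_apply c (is_diff_id x0)).
(* The Leibniz rule differentiates in [s] a function that invariance makes constant near 0, so the
   three terms add up to zero. *)
have [_ D] := is_derive_variable_bilinear wl wr (is_derive_flow_curve zeta)
  (is_derive_tangent_flow zeta a) (is_derive_tangent_flow zeta b) z0 (t0 a) (t0 b) w_diff.
have E0 := etrans (near_eq_derive (1 : R) H) (derive_cst (w x0 a b) (0 : R) (1 : R)).
move: (etrans (esym D) E0); rewrite -addrA -deriveE; last exact: w_diff.
by move=> /eqP; rewrite addr_eq0 => /eqP.
Qed.

Variables xi eta : E.
Hypothesis w_invariant : forall zeta a b, \forall s \near (0 : R),
  w (F (s *: zeta, x0)) ('d (fun x => F (s *: zeta, x)) x0 a)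
    ('d (fun x => F (s *: zeta, x)) x0 b) = w x0 a b.
Hypothesis F_action : forall zeta chi : E,
  \forall s \near (0 : R), \forall r \near (0 : R),
    F (r *: zeta, F (s *: chi, x0)) = F (r *: zeta + s *: chi, x0).

Let U := flow_generator xi.
Let V := flow_generator eta.

(* Cartan's formula: the right-hand side is the exterior derivative dw(U, V, .). *)
Lemma is_diff_contraction :
  is_diff x0 (fun x => w x (U x) (V x)) (fun a =>
    'D_(U x0) (fun x => w x (V x0) a) x0 - 'D_(V x0) (fun x => w x (U x0) a) x0
    + 'D_a (fun x => w x (U x0) (V x0)) x0).
Proof.
have D := is_diff_variable_bilinear wl wr (is_diff_id x0)
  (is_diff_flow_generator xi) (is_diff_flow_generator eta)
  erefl erefl erefl w_diff.
apply: (@is_diff_eq _ _ _ _ _ _ _ D); apply/funext => a.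
rewrite !lie_derivative_eq0 // -deriveE; last exact: w_diff.
(* This is the vanishing of the bracket: both sides are mixed second derivatives of [F] in the two
   torus directions, in opposite orders. *)
have -> : lin xi (V x0) = lin eta (U x0).
  have E1 := flow_generators_commute (F_action xi eta).
  have E2 := flow_generators_commute (F_action eta xi).
  exact: (etrans E1 (etrans (mixed_derivatives_mx_eq (xi, 0) (eta, 0) A0 C2) (esym E2))).
(* Here [l] is the term containing the vector just identified, which cancels; what remains is the
   skew-symmetry of [w], in the form [p = - p']. *)
have alg (d p p' q l : R) : p = - p' -> d + p + q = - (l + p') - - (l + q) + d.
  by move=> ->; ring.
exact: (alg _ _ _ _ _ (w_skew x0 (lin xi a) (V x0))).
Qed.
End InvariantTwoForm.
End LocalFlow.

(** * Charts, transition maps and coordinate frames *)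

Section Charts.
Context {R : realType} {n : nat} {M : manifold R n}.
Implicit Types (c d : chart R n M) (q : M) (x : 'rV[R]_n).

Lemma chart_inv_dom c x : chart_image c x -> chart_dom c (chart_inv c x).
Proof. by move=> [q cq <-]; rewrite chart_funK. Qed.

Lemma chart_invK c x : chart_image c x -> c (chart_inv c x) = x.
Proof. by move=> [q cq <-]; rewrite chart_funK. Qed.

Lemma chart_image_fun c q : chart_dom c q -> chart_image c (c q).
Proof. by move=> cq; exists q. Qed.

Lemma nbhs_chart_image c x : chart_image c x -> nbhs x (chart_image c).
Proof. by move=> cx; apply: open_nbhs_nbhs; split => //; exact: chart_image_open. Qed.

Lemma nbhs_chart_dom c q : chart_dom c q -> nbhs q (chart_dom c).
Proof. by move=> cq; apply: open_nbhs_nbhs; split => //; exact: chart_dom_open. Qed.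

Lemma chart_inv_continuous_at c x : chart_image c x -> {for x, continuous (chart_inv c)}.
Proof.
move=> cx; have := @chart_inv_continuous _ _ _ c.
rewrite continuous_open_subspace; last exact: chart_image_open.
by move=> /(_ x); apply; rewrite inE.
Qed.

Lemma near_chart_inv c d x : chart_image c x -> chart_dom d (chart_inv c x) ->
  \forall y \near x, chart_image c y /\ chart_dom d (chart_inv c y).
Proof.
move=> cx dx; apply: filterI; first exact: nbhs_chart_image.
exact: (chart_inv_continuous_at cx (nbhs_chart_dom dx)).
Qed.

Lemma differentiable_transition c d x : atlas c -> atlas d ->
  chart_image c x -> chart_dom d (chart_inv c x) ->
  differentiable (d \o chart_inv c) x.
Proof.
move=> ac ad cx dx; have [+ _] := atlas_smooth ac ad 1%N; apply.
by exists (chart_inv c x); [split=> //; exact: chart_inv_dom | exact: chart_invK].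
Qed.

Lemma is_diff_chart_tangent_inv c x : atlas c -> chart_image c x ->
  is_diff x (chart_at (chart_inv c x) \o chart_inv c) (chart_tangent_inv c x).
Proof.
move=> ac cx; apply: differentiableP.
by apply: differentiable_transition => //; [exact: chart_at_atlas | exact: chart_at_dom].
Qed.

Lemma chart_tangent_inv_linear c x k a b :
  chart_tangent_inv c x (k *: a + b) =
  k *: chart_tangent_inv c x a + chart_tangent_inv c x b.
Proof. by rewrite /chart_tangent_inv linearP. Qed.

End Charts.

(** * The exponential map of the torus is a homomorphism *)

Section TorusExponential.
Context {R : realType}.
Implicit Types (s t : 'rV[R]_2).

Lemma torus2_exp0 : torus2_exp (0 : 'rV[R]_2) = 1.
Proof. by rewrite /torus2_exp !mxE cos0 sin0. Qed.

Lemma torus2_expD s t : torus2_exp (s + t) = torus2_exp s * torus2_exp t.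
Proof.
rewrite /torus2_exp !mxE !cosD !sinD; congr (_, _); congr (_ +i* _)%C;
  by rewrite addrC mulrC [X in _ + X]mulrC.
Qed.

Lemma torus2_torus2_exp s : torus2 (torus2_exp s).
Proof.
have unit_circle (a : R) : `|(cos a +i* sin a)%C| = 1.
  by rewrite normc_def /= cos2Dsin2 sqrtr1.
by split; exact: unit_circle.
Qed.

End TorusExponential.

(** * The torus action read in charts *)

Section LocalAction.
Context {R : realType} {n : nat} {M : manifold R n}.
Variable act : R[i] * R[i] -> M -> M.
Hypothesis act_smooth : smooth_torus_action act.
Hypothesis act1 : forall q, act 1 q = q.
Hypothesis actM : forall z w q, torus2 z -> torus2 w -> act (z * w) q = act z (act w q).

Definition local_action_dom (c d : chart R n M) : set ('rV[R]_2 * 'rV[R]_n) :=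
  [set z | chart_image c z.2 /\ chart_dom d (act (torus2_exp z.1) (chart_inv c z.2))].

Definition local_action (c d : chart R n M) (z : 'rV[R]_2 * 'rV[R]_n) : 'rV[R]_n :=
  d (act (torus2_exp z.1) (chart_inv c z.2)).

(** The joint continuity of the action, composed with the continuous inverse chart, makes this
    domain a neighbourhood of each of its points. *)
Lemma nbhs_local_action_dom c d z :
  local_action_dom c d z -> nbhs z (local_action_dom c d).
Proof.
move: z => [t x] [/= cx dx].
have ci := chart_inv_continuous_at cx.
have c1 : (fun z : 'rV[R]_2 * 'rV[R]_n => (z.1, chart_inv c z.2)) @ (t, x) -->
    ((t, chart_inv c x) : 'rV[R]_2 * M).
  apply: (@cvg_pair _ _ _ _ (nbhs t) (nbhs (chart_inv c x))); first exact: cvg_fst.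
  exact: (cvg_comp _ _ (@cvg_snd _ _ (nbhs t) (nbhs x) _) ci).
apply: filterI.
  exact: (@cvg_snd _ _ (nbhs t) (nbhs x) _ _ (nbhs_chart_image cx)).
have [actc _] := act_smooth.
exact: (cvg_comp _ _ c1 (actc (t, chart_inv c x)) _ (nbhs_chart_dom dx)).
Qed.

Lemma smooth_local_action c d : atlas c -> atlas d ->
  smooth_on (local_action_dom c d) (local_action c d).
Proof. by move=> ac ad; have [_] := act_smooth; apply. Qed.

Lemma differentiable_local_action c d t x : atlas c -> atlas d ->
  local_action_dom c d (t, x) -> differentiable (fun y => local_action c d (t, y)) x.
Proof.
move=> ac ad cdx; have [+ _] := smooth_local_action ac ad 1%N.
move=> /(_ _ cdx) dF.
have D1 : is_diff x (fun y => (cst t y, id y)) (fun a => (0 a, id a)).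
  exact: is_diff_pair.
exact: (differentiable_comp (@ex_diff _ _ _ _ _ _ _ D1) dF).
Qed.

Lemma near_local_action_dom c d t x : local_action_dom c d (t, x) ->
  \forall y \near x, local_action_dom c d (t, y).
Proof.
move=> /nbhs_local_action_dom cdx.
exact: (cvg_pair (cvg_cst t) (@cvg_id _ (nbhs x)) cdx).
Qed.

Lemma local_action_dom0 c x : chart_image c x -> local_action_dom c c (0, x).
Proof. by move=> cx; split=> //=; rewrite torus2_exp0 act1; exact: chart_inv_dom. Qed.

Lemma local_action0 c x : chart_image c x -> local_action c c (0, x) = x.
Proof. by move=> cx; rewrite /local_action /= torus2_exp0 act1 chart_invK. Qed.

Lemma local_actionD c x s t : local_action_dom c c (s, x) ->
  local_action c c (t, local_action c c (s, x)) = local_action c c (t + s, x).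
Proof.
move=> [/= cx dx]; rewrite /local_action /= chart_funK // torus2_expD actM //;
  exact: torus2_torus2_exp.
Qed.

(** Both sides are the differential at [x] of the action read from [c] to the preferred chart at the
    image point: the left factors it through the preferred chart at the source, the right through
    [c]. The type annotation is there because the two sides are tangent at points that are only
    provably equal. *)
Lemma tangent_map_act c t x a : atlas c -> local_action_dom c c (t, x) ->
  tangent_map (act (torus2_exp t)) (chart_tangent_inv c x a) =
  chart_tangent_inv c (local_action c c (t, x))
    ('d (fun y => local_action c c (t, y)) x a) :> 'rV[R]_n.
Proof.
move=> ac cdx; have [/= cx fx] := cdx.
set q := chart_inv c x; set f := act (torus2_exp t).
set e := chart_at q; set d := chart_at (f q).
have ae : atlas e by exact: chart_at_atlas.
have ad : atlas d by exact: chart_at_atlas.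
have eq_dom : chart_dom e q by exact: chart_at_dom.
have fq : chart_inv c (local_action c c (t, x)) = f q by rewrite /local_action /= chart_funK.
have D1 := is_diff_chart_tangent_inv ac cx.
have D2 : differentiable (d \o (f \o chart_inv e)) (e q).
  apply: (differentiable_local_action (t := t)) => //.
  split; first exact: chart_image_fun.
  by rewrite /= chart_funK //; exact: chart_at_dom.
have D3 := is_diff_comp D1 (differentiableP D2).
have D4 := differentiableP (differentiable_local_action ac ac cdx).
have D5 : differentiable (d \o chart_inv c) (local_action c c (t, x)).
  apply: differentiable_transition => //; first exact: chart_image_fun.
  by rewrite fq; exact: chart_at_dom.
have D6 := is_diff_comp D4 (differentiableP D5).
rewrite -[LHS](is_diff_apply a D3) /chart_tangent_inv fq -[RHS](is_diff_apply a D6).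
(* The two factorisations agree only where the charts undo their inverses, hence on a neighbourhood
   of [x]. *)
have E : \forall y \near x,
    ((d \o chart_inv c) \o (fun y => local_action c c (t, y))) y =
    ((d \o (f \o chart_inv e)) \o (e \o chart_inv c)) y.
  near=> y.
  have [_ ye] : chart_image c y /\ chart_dom e (chart_inv c y).
    by near: y; exact: near_chart_inv.
  have [_ /= yc] : local_action_dom c c (t, y) by near: y; exact: near_local_action_dom.
  by rewrite /local_action /= !chart_funK.
have D7 := near_eq_is_diff E (@ex_diff _ _ _ _ _ _ _ D6).
exact: (is_diff_apply a D7).
Unshelve. all: by end_near. Qed.

End LocalAction.

(** * Two-forms as functions of two vectors, and their exterior derivative *)

Lemma tuple2E (T : Type) (v : 2.-tuple T) : v = [tuple tnth v ord0; tnth v ord_max].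
Proof.
case/tupleP: v => a v; case/tupleP: v => b v; rewrite (tuple0 v).
by apply: val_inj.
Qed.

Lemma tuple_set2l (T : Type) (a b x : T) : tuple_set [tuple a; b] ord0 x = [tuple x; b].
Proof. by rewrite [LHS]tuple2E !tnth_mktuple. Qed.

Lemma tuple_set2r (T : Type) (a b x : T) : tuple_set [tuple a; b] ord_max x = [tuple a; x].
Proof. by rewrite [LHS]tuple2E !tnth_mktuple. Qed.

Section TwoForm.
Context {R : realType} {n : nat} {M : manifold R n}.
Variable s : Defs.form M 2.

Lemma form2_linearl p k (a a' b : tangent p) :
  s p [tuple k *: a + a'; b] = k * s p [tuple a; b] + s p [tuple a'; b].
Proof.
by have := form_multilinear s [tuple a; b] ord0 k a a'; rewrite !tuple_set2l.
Qed.

Lemma form2_linearr p k (a b b' : tangent p) :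
  s p [tuple a; k *: b + b'] = k * s p [tuple a; b] + s p [tuple a; b'].
Proof.
by have := form_multilinear s [tuple a; b] ord_max k b b'; rewrite !tuple_set2r.
Qed.

Lemma form2_alternating p (a : tangent p) : s p [tuple a; a] = 0.
Proof. exact: (form_alternating s (i := ord0) (j := ord_max)). Qed.

(** Polarisation of the alternating property at [a + b]; the coefficient 1 only matches the shape of
    linearity. *)
Lemma form2_skew p (a b : tangent p) : s p [tuple a; b] = - s p [tuple b; a].
Proof.
have := form2_alternating (1 *: a + b).
rewrite form2_linearl !form2_linearr !form2_alternating !mul1r addr0 add0r.
by move=> /eqP; rewrite addr_eq0 => /eqP.
Qed.

(** A curried [coord_expr], in the shape of the point-dependent bilinear forms differentiated
    above. *)
Definition coord_form2 (c : chart R n M) (x a b : 'rV[R]_n) : R :=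
  s (chart_inv c x) [tuple chart_tangent_inv c x a; chart_tangent_inv c x b].

Lemma coord_expr2E c (a b : 'rV[R]_n) :
  coord_expr s c [tuple a; b] = fun x => coord_form2 c x a b.
Proof.
apply/funext => x; rewrite /coord_expr /coord_form2; congr (s _ _).
by rewrite [LHS]tuple2E !tnth_mktuple.
Qed.

Lemma ext_d_form2 p (a b c : tangent p) :
  ext_d s [tuple a; b; c] =
  'D_a (fun x => coord_form2 (chart_at p) x b c) (chart_at p p)
  - 'D_b (fun x => coord_form2 (chart_at p) x a c) (chart_at p p)
  + 'D_c (fun x => coord_form2 (chart_at p) x a b) (chart_at p p).
Proof.
pose i2 : 'I_3 := lift ord0 (lift ord0 ord0).
have E0 : [tuple tnth [tuple a; b; c] (lift ord0 j) | j < 2] = [tuple b; c].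
  by rewrite [LHS]tuple2E !tnth_mktuple.
have E1 : [tuple tnth [tuple a; b; c] (lift (lift ord0 ord0) j) | j < 2] = [tuple a; c].
  by rewrite [LHS]tuple2E !tnth_mktuple.
have E2 : [tuple tnth [tuple a; b; c] (lift i2 j) | j < 2] = [tuple a; b].
  by rewrite [LHS]tuple2E !tnth_mktuple.
rewrite -!coord_expr2E /ext_d !big_ord_recl big_ord0 E0 E1 E2 addr0 expr0 expr1.
by rewrite sqrrN expr1n !mul1r mulN1r addrA.
Qed.

End TwoForm.

(** * The differential of the multi-moment map *)

Section MultiMoment.
Context {R : realType} {M : manifold R 6} {S : su3_structure M}.
Variable act : R[i] * R[i] -> M -> M.
Hypothesis symS : two_torus_symmetry S act.

Let sigma := su3_sigma S.
Let act_smooth := tts_smooth symS.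
Let act1 := tts_one symS.
Let actM := tts_mul symS.

(** [generator] uses a preferred chart that changes with the point. Reading it at all points of one
    chart [c] makes it a vector field that can be differentiated. *)
Lemma generatorE c x (zeta : 'rV[R]_2) : atlas c -> chart_image c x ->
  generator act zeta (chart_inv c x) =
  chart_tangent_inv c x (flow_generator (local_action act c c) zeta x) :> 'rV[R]_6.
Proof.
move=> ac cx; set q := chart_inv c x; set F := local_action act c c.
have dom0 := local_action_dom0 act1 cx.
have A0 := nbhs_local_action_dom act_smooth dom0.
have C2 := smooth_local_action act_smooth ac ac 2%N.
have F0 : \forall y \near x, F (0, y) = y.
  by apply: filterS (nbhs_chart_image cx) => y; exact: local_action0.
have D1 := is_derive_is_diff (is_derive_flow_curve A0 C2 zeta).
have Fx : F (0 *: zeta, x) = x by rewrite scale0r; exact: nbhs_singleton F0.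
have D2 : is_diff (F (0 *: zeta, x)) (chart_at q \o chart_inv c) (chart_tangent_inv c x).
  by rewrite Fx; exact: is_diff_chart_tangent_inv.
have D3 := is_diff_comp D1 D2.
rewrite /generator derive1E -[X in chart_tangent_inv c x X]scale1r.
rewrite -[RHS](is_diff_deriveE (1 : R) D3); apply: near_eq_derive.
near=> t.
have [_ /= ft] : local_action_dom act c c (t *: zeta, x).
  by near: t; exact: (near_line_dom zeta A0).
by rewrite /F /local_action /= chart_funK.
Unshelve. all: by end_near. Qed.

Variables xi eta : 'rV[R]_2.
Let U := generator act xi.
Let V := generator act eta.
Let nu (q : M) : R := sigma q [tuple U q; V q].

Lemma differential_multimoment p (v : tangent p) :
  differential nu v = ext_d sigma [tuple U p; V p; v].
Proof.
set c := chart_at p; set x0 := c p.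
have ac : atlas c by exact: chart_at_atlas.
have cx : chart_image c x0 by apply: chart_image_fun; exact: chart_at_dom.
have px : chart_inv c x0 = p by rewrite chart_funK //; exact: chart_at_dom.
set F := local_action act c c.
have dom0 := local_action_dom0 act1 cx.
have A0 := nbhs_local_action_dom act_smooth dom0.
have C2 := smooth_local_action act_smooth ac ac 2%N.
have F0 : \forall y \near x0, F (0, y) = y.
  by apply: filterS (nbhs_chart_image cx) => y; exact: local_action0.
pose w := coord_form2 sigma c.
have wl x k a a' b : w x (k *: a + a') b = k * w x a b + w x a' b.
  by rewrite /w /coord_form2 chart_tangent_inv_linear form2_linearl.
have wr x k a b b' : w x a (k *: b + b') = k * w x a b + w x a b'.
  by rewrite /w /coord_form2 chart_tangent_inv_linear form2_linearr.
have w_skew x a b : w x a b = - w x b a by exact: form2_skew.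
have w_diff a b : differentiable (fun x => w x a b) x0.
  have [+ _] := form_smooth sigma ac [tuple a; b] 1%N.
  by rewrite coord_expr2E; apply.
(* Invariance of [sigma] under the torus element [torus2_exp (s *: zeta)], transported to the chart
   by [tangent_map_act]. *)
have w_inv zeta a b : \forall s \near (0 : R),
    w (F (s *: zeta, x0)) ('d (fun x => F (s *: zeta, x)) x0 a)
      ('d (fun x => F (s *: zeta, x)) x0 b) = w x0 a b.
  near=> s.
  have sx : local_action_dom act c c (s *: zeta, x0).
    by near: s; exact: (near_line_dom zeta A0).
  have Ta := tangent_map_act act_smooth a ac sx.
  have Tb := tangent_map_act act_smooth b ac sx.
  have [_ /= fs] := sx.
  rewrite /w /coord_form2 -Ta -Tb.
  have := tts_sigma symS (torus2_torus2_exp (s *: zeta))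
    [tuple chart_tangent_inv c x0 a; chart_tangent_inv c x0 b].
  rewrite /pullback [X in su3_sigma S _ X]tuple2E !tnth_mktuple /= => <-.
  by rewrite /F /local_action /= chart_funK.
have F_act (zeta chi : 'rV[R]_2) : \forall s \near (0 : R), \forall r \near (0 : R),
    F (r *: zeta, F (s *: chi, x0)) = F (r *: zeta + s *: chi, x0).
  near=> s; near=> r; apply: local_actionD => //.
  by near: s; exact: (near_line_dom chi A0).
have D := is_diff_contraction A0 C2 F0 wl wr w_skew w_diff xi eta w_inv F_act.
(* Near [p] the values of [nu] come from other preferred charts; [generatorE] brings them all into
   [c]. *)
have nuE : \forall x \near x0, w x (flow_generator F xi x) (flow_generator F eta x) =
    (nu \o chart_inv c) x.
  near=> x.
  have ix : chart_image c x by near: x; exact: nbhs_chart_image.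
  exact: (congr2 (fun a b => sigma (chart_inv c x) [tuple a; b])
    (esym (generatorE xi ac ix)) (esym (generatorE eta ac ix))).
have D' := near_eq_is_diff nuE (@ex_diff _ _ _ _ _ _ _ D).
rewrite /differential (is_diff_apply v D') (is_diff_apply v D) ext_d_form2.
(* At [p] itself [c] is the preferred chart, so no change of coordinates intervenes. *)
have gen zeta : flow_generator F zeta x0 = generator act zeta p.
  have [_ <-] := is_derive_flow_curve A0 C2 zeta.
  by rewrite /generator derive1E /F /local_action /= px.
by rewrite !gen.
Unshelve. all: by end_near. Qed.

End MultiMoment.

(** * Small determinants and wedge products of one-forms *)

Lemma det_mx22 (R : comPzRingType) (A : 'M[R]_2) :
  \det A = A ord0 ord0 * A ord_max ord_max - A ord0 ord_max * A ord_max ord0.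
Proof.
rewrite (expand_det_row _ ord0) !big_ord_recl big_ord0 /cofactor !det_mx11 !mxE /=.
rewrite !expr0 expr1 mul1r mulN1r mulrN addr0.
by congr (_ * A _ _ - A _ _ * A _ _); apply: val_inj.
Qed.

Lemma det_mx33 (R : comPzRingType) (A : 'M[R]_3) (a := A ord0) (b := A (inord 1))
    (c := A ord_max) :
  \det A = a ord0 * (b (inord 1) * c ord_max - b ord_max * c (inord 1))
    - a (inord 1) * (b ord0 * c ord_max - b ord_max * c ord0)
    + a ord_max * (b ord0 * c (inord 1) - b (inord 1) * c ord0).
Proof.
rewrite (expand_det_row _ ord0) !big_ord_recl big_ord0 /cofactor !det_mx22 !mxE /=.
have E1 : lift ord0 ord0 = inord 1 :> 'I_3 by apply: val_inj; rewrite /= inordK.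
have E2 : lift ord0 ord_max = ord_max :> 'I_3 by exact: val_inj.
have E3 : lift ord0 (lift ord0 ord0) = ord_max :> 'I_3 by exact: val_inj.
have E4 : lift (inord 1) ord0 = ord0 :> 'I_3 by apply: val_inj; rewrite /= inordK.
have E5 : lift (inord 1) ord_max = ord_max :> 'I_3 by apply: val_inj; rewrite /= inordK.
have E6 : lift ord_max ord0 = ord0 :> 'I_3 by exact: val_inj.
have E7 : lift ord_max ord_max = inord 1 :> 'I_3 by apply: val_inj; rewrite /= inordK.
rewrite E3 !E1 !E2 !E4 !E5 !E6 !E7 addr0 addrA.
rewrite -[(0 + bump 0 0)%N]/1%N -[(0 + bump 0 (bump 0 0))%N]/2%N.
by rewrite expr0 expr1 sqrrN expr1n !mul1r mulN1r mulrN.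
Qed.

Section WedgeOfOneForms.
Context {F : numFieldType} {V : Type}.

(** The sum over permutations is the Leibniz expansion of a determinant, and the factorials are
    1. *)
Lemma wedge_oneform2 (a b : V -> F) (v : 2.-tuple V) :
  wedge (oneform a) (oneform b) v =
  a (tnth v ord0) * b (tnth v ord_max) - a (tnth v ord_max) * b (tnth v ord0).
Proof.
pose A : 'M[F]_2 := \matrix_(i, j) (if i == ord0 then a else b) (tnth v j).
transitivity (\det A); last by rewrite det_mx22 !mxE.
rewrite /wedge -[(1`! * 1`!)%:R]/1 invr1 mul1r; apply: eq_bigr => s _; congr (_ * _).
rewrite !big_ord_recl big_ord0 mulr1 !mxE /oneform /thead !tnth_mktuple /=.
by congr (a (tnth v (s _)) * b (tnth v (s _))); apply: val_inj.
Qed.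

(** Expanding the inner wedge splits the permutation sum into two determinants that differ by
    exchanging [a] and [b], hence by a sign; the factor one half from [2! 1!] compensates the
    doubling. *)
Lemma wedge_oneform3 (a b c : V -> F) (u v w : V) :
  wedge (wedge (oneform a) (oneform b)) (oneform c) [tuple u; v; w] =
  a u * (b v * c w - b w * c v) - a v * (b u * c w - b w * c u)
    + a w * (b u * c v - b v * c u).
Proof.
pose t : 3.-tuple V := [tuple u; v; w].
pose A (a b : V -> F) : 'M[F]_3 :=
  \matrix_(i, j) (if i == ord0 then a else if i == ord_max then c else b) (tnth t j).
have detA (a' b' : V -> F) : \det (A a' b') =
    a' u * (b' v * c w - b' w * c v) - a' v * (b' u * c w - b' w * c u)
    + a' w * (b' u * c v - b' v * c u).
  have -> : u = tnth t ord0 by [].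
  have -> : v = tnth t (inord 1) by rewrite (tnth_nth u) inordK.
  have -> : w = tnth t ord_max by [].
  by rewrite det_mx33 !mxE -!val_eqE /= !inordK.
transitivity (2%:R^-1 * (\det (A a b) - \det (A b a))).
  rewrite /wedge; congr (_ * _).
  rewrite -sumrB; apply: eq_bigr => s _; rewrite -mulrBr; congr (_ * _).
  rewrite [X in X * _](@wedge_oneform2 a b) !tnth_mktuple.
  rewrite !big_ord_recl !big_ord0 !mxE /oneform /thead tnth_mktuple /= !mulr1.
  have -> : lshift 1 (ord0 : 'I_2) = ord0 :> 'I_3 by exact: val_inj.
  have -> : lshift 1 (ord_max : 'I_2) = lift ord0 ord0 :> 'I_3 by exact: val_inj.
  have -> : rshift 2 (ord0 : 'I_1) = lift ord0 (lift ord0 ord0) :> 'I_3 by exact: val_inj.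
  by rewrite -/t mulrBl -!mulrA [b _ * (a _ * _)]mulrCA.
by rewrite !detA; field.
Qed.

End WedgeOfOneForms.

(** * Real and imaginary parts *)

Section ComplexParts.
Context {R : rcfType}.

Lemma ReM (a b : R[i]) : complex.Re (a * b) =
  complex.Re a * complex.Re b - complex.Im a * complex.Im b.
Proof. by case: a b => ? ? []. Qed.

Lemma ImM (a b : R[i]) : complex.Im (a * b) =
  complex.Re a * complex.Im b + complex.Im a * complex.Re b.
Proof. by case: a b => ? ? []. Qed.

Lemma ReD (a b : R[i]) : complex.Re (a + b) = complex.Re a + complex.Re b.
Proof. by case: a b => ? ? []. Qed.

Lemma ImD (a b : R[i]) : complex.Im (a + b) = complex.Im a + complex.Im b.
Proof. by case: a b => ? ? []. Qed.

Lemma ReN (a : R[i]) : complex.Re (- a) = - complex.Re a.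
Proof. by case: a. Qed.

Lemma ImN (a : R[i]) : complex.Im (- a) = - complex.Im a.
Proof. by case: a. Qed.

Lemma sum_sqr_complex_eq0 (z : R[i]) :
  complex.Re z ^+ 2 + complex.Im z ^+ 2 = 0 -> z = 0.
Proof.
case: z => a b /= /eqP; rewrite paddr_eq0 ?sqr_ge0 // !sqrf_eq0.
by move=> /andP[/eqP-> /eqP->].
Qed.

End ComplexParts.

(** * Hermitian linear algebra on a tangent space *)

Section HermitianPlane.
Context {R : realType} {M : manifold R 6} (S : su3_structure M) (p : M).
Let g := su3_g S p.
Let J : tangent p -> tangent p := su3_J S p.
Implicit Types (u v w : tangent p).

Lemma metricDl u v w : g (u + v) w = g u w + g v w.
Proof. by have := metric_linear (su3_g S) 1 u v w; rewrite scale1r mul1r. Qed.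

Lemma metric0l w : g 0 w = 0.
Proof. by apply: (addIr (g 0 w)); rewrite -metricDl !add0r. Qed.

Lemma metricZl a u w : g (a *: u) w = a * g u w.
Proof. by have := metric_linear (su3_g S) a u 0 w; rewrite !addr0 -/g metric0l addr0. Qed.

Lemma metricC u v : g u v = g v u. Proof. exact: (Defs.metric_sym (su3_g S)). Qed.

Lemma metricDr u v w : g w (u + v) = g w u + g w v.
Proof. by rewrite metricC metricDl !(metricC w). Qed.

Lemma metricZr a u w : g w (a *: u) = a * g w u.
Proof. by rewrite metricC metricZl (metricC w). Qed.

Lemma metric_sumr (I : finType) (c : I -> R) (X : I -> tangent p) w :
  g w (\sum_i c i *: X i) = \sum_i c i * g w (X i).
Proof.
elim/big_rec2: _ => [|i y z _ <-]; first by rewrite metricC metric0l.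
by rewrite metricDr metricZr.
Qed.

Lemma metric_eq0 u : g u u = 0 -> u = 0.
Proof.
move=> gu; apply/eqP; apply: contraT => /(metric_pos (su3_g S)).
by rewrite -/g gu ltxx.
Qed.

Lemma metric_J u v : g (J u) (J v) = g u v. Proof. exact: (su3_J_orthogonal S). Qed.

Lemma JJ v : J (J v) = - v. Proof. exact: (acs_sqr (su3_J S)). Qed.

Lemma metric_Jr u v : g u (J v) = - g (J u) v.
Proof. by rewrite -metric_J JJ -scaleN1r metricZr mulN1r. Qed.

Lemma metric_Jxx u : g (J u) u = 0.
Proof.
have := metric_Jr u u; rewrite metricC => /eqP.
by rewrite -addr_eq0 -mulr2n mulrn_eq0 => /eqP.
Qed.

(** The last two squares add up to the squared modulus of the Hermitian product of [u] and [v]. *)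
Definition hermitian_gram u v := g u u * g v v - g u v ^+ 2 - g (J u) v ^+ 2.

Lemma hermitian_gramC u v : hermitian_gram u v = hermitian_gram v u.
Proof.
by rewrite /hermitian_gram (metricC v u) (metricC (J v)) metric_Jr sqrrN [g v v * _]mulrC.
Qed.

Lemma cscaleN z u : Defs.cscale (su3_J S) (- z) u = - Defs.cscale (su3_J S) z u.
Proof. by case: z => a b; rewrite /Defs.cscale /= !scaleNr opprD. Qed.

Lemma hermitian_gram_cscalel z u v :
  hermitian_gram (Defs.cscale (su3_J S) z u) v =
  (complex.Re z ^+ 2 + complex.Im z ^+ 2) * hermitian_gram u v.
Proof.
rewrite /Defs.cscale /hermitian_gram -/J; case: z => a b /=.
have -> : J (a *: u + b *: J u) = a *: J u + (- b) *: u.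
  by rewrite /J linearD !linearZ /= -/J JJ scalerN scaleNr.
rewrite !(metricDl, metricDr, metricZl, metricZr).
rewrite metric_J metric_Jr metric_Jxx.
by ring.
Qed.

Lemma hermitian_gram_cscaler z u : hermitian_gram u (Defs.cscale (su3_J S) z u) = 0.
Proof.
rewrite hermitian_gramC hermitian_gram_cscalel /hermitian_gram metric_Jxx.
by ring.
Qed.

(* The Cauchy-Schwarz equality case for the Hermitian form g + i sigma. *)
Lemma complex_dependentP u v :
  complex_dependent (su3_J S) u v <-> hermitian_gram u v = 0.
Proof.
(* If [z u' = - w v'], the Gram determinant of [z u'] and [v'] vanishes, and it is [|z|^2] times
   that of [u'] and [v']. *)
have gram0 (z w : R[i]) u' v' :
    Defs.cscale (su3_J S) z u' + Defs.cscale (su3_J S) w v' = 0 ->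
    z != 0 -> hermitian_gram u' v' = 0.
  move=> /eqP; rewrite addr_eq0 -cscaleN => /eqP E zN0.
  have := hermitian_gram_cscaler (- w) v'; rewrite -E hermitian_gramC.
  rewrite hermitian_gram_cscalel => /eqP; rewrite mulf_eq0 => /orP[/eqP|/eqP //].
  by move=> /sum_sqr_complex_eq0 z0; rewrite z0 eqxx in zN0.
split.
  move=> [z [w [zw E]]]; have [z0|] := eqVneq z 0; last exact: gram0 E.
  rewrite hermitian_gramC; rewrite addrC in E; apply: gram0 E _.
  by move: zw; rewrite z0 xpair_eqE eqxx.
move=> E; have [u0|uN0] := eqVneq u 0.
  exists 1, 0; split; first by rewrite xpair_eqE oner_eq0.
  by rewrite /Defs.cscale /= u0 !scale0r scaler0 !addr0.
have gu : 0 < g u u by exact: (metric_pos (su3_g S)).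
(* These coefficients form [g u u] times the component of [v] orthogonal to [u] and [J u]; its
   squared norm is [g u u] times the Gram determinant. *)
exists (- g u v -i* g (J u) v)%C, ((g u u)%:C)%C; split.
  by rewrite xpair_eqE negb_and orbC eq_complex /= (gt_eqF gu).
rewrite /Defs.cscale /= scale0r addr0 -/J; apply: metric_eq0.
transitivity (g u u * hermitian_gram u v); last by rewrite E mulr0.
rewrite /hermitian_gram !(metricDl, metricDr, metricZl, metricZr).
rewrite metric_J metric_Jr metric_Jxx.
rewrite (metricC v u) (metricC v (J u)).
by ring.
Qed.

(* In an adapted frame, psi_+(u, v, .) has the coordinates of the complex cross
   product of u and v, and the sum of their squares is the Lagrange identity. *)
Lemma psip_contraction_eq0 u v :
  (forall w, su3_psip S p [tuple u; v; w] = 0) <-> hermitian_gram u v = 0.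
Proof.
have [E [Xb Xo _ psiE]] := su3_frame S p.
pose X : (3 + 3).-tuple (tangent p) := [tuple of E ++ map (su3_J S p) E].
pose theta (i : 'I_3) w : R[i] := (coord X (lshift 3 i) w +i* coord X (rshift 3 i) w)%C.
have {}Xb : basis_of fullv X := Xb.
have {}Xo i j : g (tnth X i) (tnth X j) = (i == j)%:R := Xo i j.
have {}psiE (t : 3.-tuple (tangent p)) : (su3_psip S p t +i* su3_psim S p t)%C =
    wedge (wedge (oneform (theta (inord 0))) (oneform (theta (inord 1))))
      (oneform (theta (inord 2))) t := psiE t.
have XE i : tnth X (lshift 3 i) = tnth E i by exact: tnth_lshift.
have XJ i : tnth X (rshift 3 i) = J (tnth E i).
  by rewrite /X tnth_rshift tnth_map.
have sumX b : b = \sum_k coord X k b *: tnth X k.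
  rewrite {1}(coord_basis Xb (memvf b)).
  by apply: eq_bigr => k _; rewrite (tnth_nth 0).
(* Orthonormality of the frame turns dual coordinates into inner products. *)
have coordE k w : coord X k w = g w (tnth X k).
  rewrite [in RHS](sumX w) metricC metric_sumr.
  rewrite (bigD1 k) //= Xo eqxx mulr1 big1 ?addr0 // => i ik.
  by rewrite Xo eq_sym (negPf ik) mulr0.
pose x i w := g w (tnth E i); pose y i w := g w (J (tnth E i)).
have sum3 (f : 'I_3 -> R) : \sum_i f i = f (inord 0) + f (inord 1) + f (inord 2).
  rewrite !big_ord_recl big_ord0 addr0 addrA.
  by congr (f _ + f _ + f _); apply: val_inj; rewrite /= inordK.
have gE a b : g a b = x (inord 0) a * x (inord 0) b + x (inord 1) a * x (inord 1) b
    + x (inord 2) a * x (inord 2) b + y (inord 0) a * y (inord 0) b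
    + y (inord 1) a * y (inord 1) b + y (inord 2) a * y (inord 2) b.
  rewrite [in LHS](sumX b) metric_sumr big_split_ord /=.
  rewrite !sum3 !coordE !XE !XJ /x /y.
  by ring.
have xJ i w : x i (J w) = - y i w by rewrite /x /y metric_Jr opprK.
have yJ i w : y i (J w) = x i w by rewrite /x /y metric_J.
have xE i j : x i (tnth E j) = (i == j)%:R.
  by rewrite /x -!XE Xo eq_sym (inj_eq (@lshift_inj _ _)).
have yE i j : y i (tnth E j) = 0.
  by rewrite /y -XJ -XE Xo eq_lrshift.
pose P w := su3_psip S p [tuple u; v; w].
pose cross i j := theta i u * theta j v - theta i v * theta j u.
have thetaE i w : theta i w = (x i w +i* y i w)%C by rewrite /theta !coordE XE XJ.
have ReC i j : complex.Re (cross i j) =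
    x i u * x j v - y i u * y j v - (x i v * x j u - y i v * y j u).
  by rewrite /cross ReD ReN !ReM !thetaE.
have ImC i j : complex.Im (cross i j) =
    x i u * y j v + y i u * x j v - (x i v * y j u + y i v * x j u).
  by rewrite /cross ImD ImN !ImM !thetaE.
set i0 : 'I_3 := inord 0 in psiE gE sum3; set i1 : 'I_3 := inord 1 in psiE gE sum3.
set i2 : 'I_3 := inord 2 in psiE gE sum3.
(* Expansion of the complex determinant along [w]; the cyclic order of the indices makes all three
   signs positive. *)
have PE w : P w = complex.Re (cross i1 i2) * x i0 w - complex.Im (cross i1 i2) * y i0 w
    + (complex.Re (cross i2 i0) * x i1 w - complex.Im (cross i2 i0) * y i1 w)
    + (complex.Re (cross i0 i1) * x i2 w - complex.Im (cross i0 i1) * y i2 w).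
  have -> : P w = complex.Re (cross i1 i2 * theta i0 w + cross i2 i0 * theta i1 w
      + cross i0 i1 * theta i2 w).
    rewrite -[LHS]/(complex.Re (P w +i* su3_psim S p [tuple u; v; w])%C).
    rewrite psiE wedge_oneform3.
    by congr complex.Re; rewrite /cross; ring.
  by rewrite 2!ReD 3!ReM !thetaE.
have gramE : hermitian_gram u v =
    complex.Re (cross i1 i2) ^+ 2 + complex.Im (cross i1 i2) ^+ 2
    + (complex.Re (cross i2 i0) ^+ 2 + complex.Im (cross i2 i0) ^+ 2)
    + (complex.Re (cross i0 i1) ^+ 2 + complex.Im (cross i0 i1) ^+ 2).
  rewrite !ReC !ImC /hermitian_gram !gE !xJ !yJ.
  move: (x i0 u) (x i1 u) (x i2 u) (y i0 u) (y i1 u) (y i2 u)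
    (x i0 v) (x i1 v) (x i2 v) (y i0 v) (y i1 v) (y i2 v) => *.
  by ring.
have [n01 n02 n12] : [/\ i0 != i1, i0 != i2 & i1 != i2].
  by rewrite -!val_eqE /= !inordK.
rewrite gramE; split=> [P0|/eqP].
  (* Evaluating at each [E_i] and [J E_i] isolates the real part and minus the imaginary part of one
     component of the cross product. *)
  have := P0 (tnth E i0); have := P0 (J (tnth E i0)).
  have := P0 (tnth E i1); have := P0 (J (tnth E i1)).
  have := P0 (tnth E i2); have := P0 (J (tnth E i2)).
  rewrite -!/(P _) !PE !xJ !yJ !xE !yE !eqxx.
  rewrite ![i1 == i0]eq_sym ![i2 == i0]eq_sym ![i2 == i1]eq_sym.
  rewrite (negPf n01) (negPf n02) (negPf n12) !(mulr1, mulr0, oppr0, addr0, add0r, subr0).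
  do 3!(move=> /eqP; rewrite oppr_eq0 => /eqP -> ->).
  by rewrite !expr0n !addr0.
have sq0 (a b : R) : 0 <= a ^+ 2 + b ^+ 2 by rewrite addr_ge0 ?sqr_ge0.
rewrite !paddr_eq0 ?addr_ge0 ?sqr_ge0 // !sqrf_eq0.
move=> /andP[/andP[/andP[/eqP r0 /eqP m0] /andP[/eqP r1 /eqP m1]] /andP[/eqP r2 /eqP m2]] w.
by rewrite -/(P w) PE r0 r1 r2 m0 m1 m2 !mul0r !subr0 !addr0.
Qed.

(** The real Gram determinant is [hermitian_gram u v + g (J u) v ^+ 2], so the right-hand side makes
    it vanish. Conversely, dependent vectors have zero real Gram determinant, and [g (J u) v]
    vanishes because [g (J u) u] does. *)
Lemma linearly_dependentP u v :
  ~~ free [:: u; v] <-> hermitian_gram u v = 0 /\ g (J u) v = 0.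
Proof.
rewrite free_cons span_seq1 negb_and negbK seq1_free negbK; split.
  rewrite /hermitian_gram => /orP[/vlineP[k ->]|/eqP ->].
    have -> : J (k *: v) = k *: J v by rewrite /J linearZ.
    by rewrite !(metricZl, metricZr) metric_Jxx; split; ring.
  by rewrite !(metricC _ 0) !metric0l; split=> //; ring.
rewrite /hermitian_gram => -[+ uv]; rewrite uv expr0n subr0 => E.
have [//|vN0] := eqVneq v 0; first by rewrite orbT.
rewrite orbF; have gv : 0 < g v v by exact: (metric_pos (su3_g S)).
(* This is [g v v] times the component of [u] orthogonal to [v], with squared norm [g v v] times the
   real Gram determinant. *)
have : g v v *: u + (- g u v) *: v = 0.
  apply: metric_eq0; transitivity (g v v * (g u u * g v v - g u v ^+ 2)).
    by rewrite !(metricDl, metricDr, metricZl, metricZr) (metricC v u); ring.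
  by rewrite E mulr0.
move=> /eqP; rewrite addr_eq0 scaleNr opprK => /eqP Euv.
apply/vlineP; exists ((g v v)^-1 * g u v).
by rewrite -scalerA -Euv scalerA mulVf ?scale1r ?gt_eqF.
Qed.

End HermitianPlane.

Local Close Scope classical_set_scope.

Theorem proposition2p1 (R : realType) (M : manifold R 6) (S : su3_structure M)
    (nkS : nearly_kahler S)
    (act : R[i] * R[i] -> M -> M) (symS : two_torus_symmetry S act)
    (xi eta : 'rV[R]_2) (basis_xi_eta : basis_of {: 'rV[R]_2} [:: xi; eta])
    (p : M) :
  let U := generator act xi in
  let V := generator act eta in
  let nu := fun q : M => su3_sigma S q [tuple U q; V q] in
  let g := su3_g S in
  let h2 := fun q : M =>
    g q (U q) (U q) * g q (V q) (V q) - g q (U q) (V q) ^+ 2 in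
  (~~ free [:: U p; V p] <-> critical nu p /\ nu p = 0) /\
  ((complex_dependent (su3_J S) (U p) (V p) <-> critical nu p) /\
   (critical nu p <-> nu p ^+ 2 = h2 p)).
Proof.
move=> U V nu g h2.
have sigmaE : nu p = g p (su3_J S p (U p)) (V p) by exact: su3_sigmaE.
have critE : critical nu p <-> hermitian_gram S (U p) (V p) = 0.
  rewrite -psip_contraction_eq0 /critical.
  (* Cartan's formula followed by the first nearly Kähler equation. *)
  have dnu v : differential nu v = 3 * su3_psip S p [tuple U p; V p; v].
    rewrite (differential_multimoment symS xi eta); exact: nkS.1.
  split=> H v; last by rewrite dnu H mulr0.
  by apply: (mulfI (_ : 3 != 0 :> R)); rewrite ?pnatr_eq0 // -dnu H mulr0.
have gramE : hermitian_gram S (U p) (V p) = h2 p - nu p ^+ 2 by rewrite sigmaE.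
split; first by rewrite critE linearly_dependentP sigmaE; exact: iff_refl.
split; first by rewrite critE complex_dependentP; exact: iff_refl.
rewrite critE gramE; split=> [/eqP|->]; last by rewrite subrr.
by rewrite subr_eq0 => /eqP.
Qed.
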